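(* Let $X,Y$ be complex Banach spaces and $\mathrm R$ a non-empty collection of sequences in $\mathbb R^n$. Let $(R(\mathbf t))_{\mathbf t>\mathbf 0}\subseteq L(X,Y)$ be a strongly continuous operator family with $\int_{(0,\infty)^n}\|R(\mathbf t)\|\,d\mathbf t<\infty$. If $f:\mathbb R^n\to X$ is bounded and $\mathrm R$-multi-almost periodic, then $$F(\mathbf t):=\int_{-\infty}^{t_1}\int_{-\infty}^{t_2}\cdots\int_{-\infty}^{t_n}R(\mathbf t-\mathbf s)f(\mathbf s)\,d\mathbf s,\quad\mathbf t=(t_1,\dots,t_n)\in\mathbb R^n,$$ is well-defined and $\mathrm R$-multi-almost periodic.
   Context: $\mathbf t>\mathbf 0$ means every component of $\mathbf t$ is strictly positive. A continuous $g:\mathbb R^n\to V$ ($V$ a Banach space) is $\mathrm R$-multi-almost periodic if for every $(\mathbf b_k)\in\mathrm R$ there exist a subsequence $(\mathbf b_{k_l})$ and $g^\ast:\mathbb R^n\to V$ with $g(\mathbf t+\mathbf b_{k_l})\to g^\ast(\mathbf t)$ uniformly for $\mathbf t\in\mathbb R^n$. *)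

(* Defs.v *)
From HB Require Import structures.
From mathcomp Require Import all_boot all_order all_algebra.
From mathcomp Require Import all_classical all_reals all_analysis.
From mathcomp Require Import complex.
Set Implicit Arguments. Unset Strict Implicit. Unset Printing Implicit Defensive.
Import Order.TTheory GRing.Theory Num.Theory.
Import numFieldNormedType.Exports.
Local Open Scope classical_set_scope.
Local Open Scope ring_scope.

Section Defs.
Variable R : realType.
Local Notation C := (R[i]).

Definition nrm (V : normedModType C) (v : V) : R := complex.Re `|v|.

Definition tadd n (s t : n.-tuple R) : n.-tuple R := [tuple tnth s i + tnth t i | i < n].
Definition tsub n (s t : n.-tuple R) : n.-tuple R := [tuple tnth s i - tnth t i | i < n].

Definition pos_orthant n : set (n.-tuple R) := [set t | forall i, 0 < tnth t i].
Definition lower_orthant n (t : n.-tuple R) : set (n.-tuple R) :=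
  [set s | forall i, tnth s i < tnth t i].
Definition box n (a b : n.-tuple R) : set (n.-tuple R) :=
  [set x | forall i, tnth a i <= tnth x i <= tnth b i].

(** mu is the n-dimensional Lebesgue measure on the Borel sets of R^n:
    the (unique) measure giving every box its volume *)
Definition is_lebesgue_n n (mu : {measure set (n.-tuple R) -> \bar R}) : Prop :=
  forall a b : n.-tuple R, (forall i, tnth a i <= tnth b i) ->
    mu (box a b) = (\prod_(i < n) (tnth b i - tnth a i))%:E.

Definition tcontinuous n (V : normedModType C) (g : n.-tuple R -> V) : Prop :=
  forall t (e : R), 0 < e -> exists2 d : R, 0 < d &
    forall s, (forall i, `|tnth s i - tnth t i| < d) -> nrm (g s - g t) < e.

Definition multi_ap n (V : normedModType C) (Rc : set (nat -> n.-tuple R))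
    (g : n.-tuple R -> V) : Prop :=
  tcontinuous g /\
  forall b, Rc b ->
    exists (k : nat -> nat) (gs : n.-tuple R -> V),
      (forall l, (k l < k l.+1)%N) /\
      forall e : R, 0 < e -> exists N : nat, forall l, (N <= l)%N ->
        forall t, nrm (g (tadd t (b (k l))) - gs t) < e.

Definition bounded_op (X Y : normedModType C) (T : X -> Y) : Prop :=
  exists M : R, forall x, nrm (T x) <= M * nrm x.
Definition opnorm (X Y : normedModType C) (T : X -> Y) : \bar R :=
  ereal_sup [set (nrm (T x))%:E | x in [set x : X | nrm x <= 1]].

Definition strongly_continuous n (X Y : normedModType C) (Rop : n.-tuple R -> X -> Y) : Prop :=
  forall (x : X) t (e : R), pos_orthant t -> 0 < e -> exists2 d : R, 0 < d &
    forall s, pos_orthant s -> (forall i, `|tnth s i - tnth t i| < d) ->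
      nrm (Rop s x - Rop t x) < e.

Definition simple_fun n (V : normedModType C) (m : nat)
    (A : 'I_m -> set (n.-tuple R)) (y : 'I_m -> V) : n.-tuple R -> V :=
  fun x => \sum_(i < m) (if `[< A i x >] then y i else 0).

Definition simple_int n (V : normedModType C) (mu : set (n.-tuple R) -> \bar R)
    (D : set (n.-tuple R)) (m : nat) (A : 'I_m -> set (n.-tuple R)) (y : 'I_m -> V) : V :=
  \sum_(i < m) (real_complex R (fine (mu (A i `&` D)))) *: y i.

Definition has_bochner_integral n (V : normedModType C)
    (mu : {measure set (n.-tuple R) -> \bar R}) (D : set (n.-tuple R))
    (g : n.-tuple R -> V) (v : V) : Prop :=
  exists (m : nat -> nat) (A : forall k, 'I_(m k) -> set (n.-tuple R))
         (y : forall k, 'I_(m k) -> V),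
    (forall k i, measurable (A k i) /\ (mu (A k i) < +oo)%E) /\
    {ae mu, forall x, D x ->
       (fun k => nrm (simple_fun (A k) (y k) x - g x)) @ \oo --> (0 : R)} /\
    (fun k => (\int[mu]_(x in D) (nrm (g x - simple_fun (A k) (y k) x))%:E)%E)
       @ \oo --> (0 : \bar R) /\
    (fun k => nrm (simple_int mu D (A k) (y k) - v)) @ \oo --> (0 : R).

End Defs.

(* Main.v *)
Require Import Defs.
From HB Require Import structures.
From mathcomp Require Import all_boot all_order all_algebra.
From mathcomp Require Import all_classical all_reals all_analysis.
From mathcomp Require Import measurable_realfun complex.
Import Order.TTheory GRing.Theory Num.Theory.
Import numFieldNormedType.Exports.
Local Open Scope classical_set_scope.
Local Open Scope ring_scope.

(** The substitution [s = t - u] turns [F t] into the integral of [R u (f (t - u))]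
    over the positive orthant, whence
    [|F t - F t'| <= \int |R u| |f (t - u) - f (t' - u)| du].
    Dominated convergence gives the continuity of [F], and uniform Cauchyness of
    the translates of [f] along a sequence passes to those of [F], which then
    converge uniformly because [Y] is complete.  The Bochner integrals exist because
    [u |-> R u (f (t - u))] has separable range, measurable distance to every
    vector, and norm at most [M |R u|]. *)

Set Implicit Arguments. Unset Strict Implicit. Unset Printing Implicit Defensive.

(** * The real-valued norm *)

Section Nrm.
Context {R : realType}.
Implicit Types V X Y : normedModType R[i].

(** The substitution is needed because both the orthant below [t] and the factor [Rop (tsub t s)]
    move with [t]; after it the domain and the operator are fixed and only the argument of [f]
    depends on [t]. Since [is_lebesgue_n] prescribes the measure on boxes alone, its invariance
    under reflection is derived from the uniqueness of measures on the pi-system of boxes. The main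
    obstacle is measurability: strong continuity controls [Rop u x] for a fixed vector [x], whereas
    the integrand applies [Rop u] to a vector that moves with [u]. The remedy is to freeze that
    vector at a nearby one and to let the error be absorbed by the norm of [Rop u] at the single
    point considered. A Bochner integral is known only as a limit of integrals of simple functions
    whose pieces may overlap, so each norm estimate is established for those before passing to the
    limit. *)

Lemma normr_nrm V (v : V) : `|v| = (nrm v)%:C%C.
Proof. by rewrite /nrm complex.RRe_real// normr_real. Qed.

Lemma nrm_ge0 V (v : V) : 0 <= nrm v.
Proof. by have := normr_ge0 v; rewrite normr_nrm lecR. Qed.

Lemma nrm0 V : nrm (0 : V) = 0.
Proof. by rewrite /nrm normr0. Qed.

Lemma nrm_eq0 V (v : V) : nrm v = 0 -> v = 0.
Proof. by move=> h; apply/eqP; rewrite -normr_eq0 normr_nrm h. Qed.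

Lemma nrmN V (v : V) : nrm (- v) = nrm v.
Proof. by rewrite /nrm normrN. Qed.

Lemma nrm_distC V (v w : V) : nrm (v - w) = nrm (w - v).
Proof. by rewrite -nrmN opprB. Qed.

Lemma ler_nrmD V (v w : V) : nrm (v + w) <= nrm v + nrm w.
Proof. by have := ler_normD v w; rewrite !normr_nrm -rmorphD lecR. Qed.

Lemma ler_nrm_distD V (u v w : V) : nrm (v - w) <= nrm (v - u) + nrm (u - w).
Proof. by rewrite (le_trans _ (ler_nrmD _ _))// addrA subrK. Qed.

Lemma ler_nrmB_dist V (v w : V) : `|nrm v - nrm w| <= nrm (v - w).
Proof.
rewrite ler_norml; apply/andP; split.
  rewrite lerNl opprB lerBlDr nrm_distC.
  by rewrite (le_trans _ (ler_nrmD _ _))// subrK.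
by rewrite lerBlDr (le_trans _ (ler_nrmD _ _))// subrK.
Qed.

Lemma nrmZ V (a : R) (v : V) : nrm (a%:C%C *: v) = `|a| * nrm v.
Proof.
have aE : `|a%:C%C| = (`|a|%:C)%C.
  by rewrite normc_def/= expr0n addr0 sqrtr_sqr.
by rewrite {1}/nrm normrZ aE normr_nrm -rmorphM.
Qed.

(** The order of [R[i]] compares only numbers with equal imaginary parts. Hence the radii of balls
    in a complex normed space are real, and epsilon arguments can be run with [nrm]. *)
Lemma gt0_complexE (e : R[i]) : 0 < e -> exists2 r : R, 0 < r & e = r%:C%C.
Proof.
move=> e0; exists (complex.Re e); first by move: e0; rewrite ltcE => /andP[].
by rewrite complex.RRe_real// gtr0_real.
Qed.

Lemma nrm_complete (V : completeNormedModType R[i]) (u : nat -> V) :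
  (forall e : R, 0 < e -> exists N, forall k l, (N <= k)%N -> (N <= l)%N ->
     nrm (u k - u l) < e) ->
  exists v, forall e : R, 0 < e -> exists N, forall k, (N <= k)%N ->
     nrm (u k - v) < e.
Proof.
move=> cu; have /cauchy_cvgP cu' : cauchy (u @ \oo).
  apply/cauchy_ballP => _ /gt0_complexE[e e0 ->].
  have [N hN] := cu e e0.
  pose tl : set V := u @` [set k | (N <= k)%N].
  have utl : (u @ \oo) tl by exists N => // k Nk; exists k.
  exists (tl, tl) => // -[_ _] [[a Na <-] [b Nb <-]].
  rewrite -ball_normE /ball_/= normr_nrm.
  by rewrite ltcR hN.
exists (lim (u @ \oo)) => e e0.
have eC : 0 < (e%:C)%C :> R[i] by rewrite ltcR.
have [N _ hN] := cvgr_distC_lt _ _ cu' _ eC.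
exists N => k Nk.
by have := hN k Nk; rewrite /= normr_nrm ltcR.
Qed.

Lemma opnorm_ge0 X Y (T : {linear X -> Y}) : (0 <= opnorm T)%E.
Proof.
rewrite /opnorm; apply: ereal_sup_ubound; exists (0 : X) => /=; first by rewrite nrm0.
by rewrite linear0 nrm0.
Qed.

(** Rescale [x] to the unit sphere. Finiteness matters because [fine] sends [+oo] to 0. *)
Lemma nrm_le_opnorm X Y (T : {linear X -> Y}) x :
  opnorm T \is a fin_num -> nrm (T x) <= fine (opnorm T) * nrm x.
Proof.
move=> Tfin; have [x0|x0] := eqVneq (nrm x) 0.
  by rewrite (nrm_eq0 x0) linear0 !nrm0 mulr0.
have xp : 0 < nrm x by rewrite lt_def x0 nrm_ge0.
rewrite -ler_pdivrMr// mulrC.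
have -> : (nrm x)^-1 * nrm (T x) = nrm (T ((nrm x)^-1%:C%C *: x)).
  by rewrite linearZ nrmZ ger0_norm// invr_ge0 ltW.
rewrite -lee_fin fineK//; rewrite /opnorm; apply: ereal_sup_ubound.
exists ((nrm x)^-1%:C%C *: x) => //=.
by rewrite nrmZ ger0_norm ?invr_ge0 ?nrm_ge0// mulVf.
Qed.

Lemma opnorm_fin_num X Y (T : {linear X -> Y}) :
  bounded_op T -> opnorm T \is a fin_num.
Proof.
move=> [M hM]; rewrite ge0_fin_numE ?opnorm_ge0//.
apply: (@le_lt_trans _ _ (`|M|)%:E); rewrite ?ltry//.
rewrite /opnorm; apply: ge_ereal_sup => _ [x /= x1 <-]; rewrite lee_fin.
rewrite (le_trans (hM x))// (le_trans (ler_norm _))// normrM.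
by rewrite (ger0_norm (nrm_ge0 _)) ler_piMr.
Qed.

End Nrm.

(** * Borel sets of tuples *)

Section TupleBorel.
Context {R : realType} {n : nat}.
Implicit Types (s t a b : n.-tuple R) (U : set (n.-tuple R)).

(** Openness for the sup distance, in the same epsilon-delta form as [tcontinuous] and
    [strongly_continuous], so that these hypotheses yield open sets directly. *)
Definition topen U := forall t, U t -> exists2 d : R, 0 < d &
  forall s, (forall i, `|tnth s i - tnth t i| < d) -> U s.

Lemma min_gt0 (x : 'I_n -> R) : (forall i, 0 < x i) ->
  exists2 d : R, 0 < d & forall i, d <= x i.
Proof.
(* The default value 1 keeps the minimum positive when [n = 0]. *)
move=> x0; exists (\big[Num.min/1]_(i < n) x i); first by apply/lt_bigmin.
by move=> i; apply: bigmin_le_cond.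
Qed.

Lemma topen_pos_orthant : topen (@pos_orthant R n).
Proof.
move=> t /min_gt0[d d0 hd]; exists d => // s hs i.
have := hs i; rewrite ltr_norml => /andP[+ _].
by rewrite ltrBrDr; apply: le_lt_trans; rewrite addrC subr_ge0.
Qed.

Lemma topen_lower_orthant t : topen (lower_orthant t).
Proof.
move=> s st; have : forall i, 0 < tnth t i - tnth s i.
  by move=> i; rewrite subr_gt0.
move=> /min_gt0[d d0 hd]; exists d => // u hu i.
have := hu i; rewrite ltr_norml => /andP[_].
by rewrite ltrBlDr => /lt_le_trans; apply; rewrite -lerBrDr.
Qed.

Lemma measurable_box a b : measurable (box a b).
Proof.
rewrite [X in measurable X](_ : _ =
  \bigcap_(i in [set: 'I_n]) ((@tnth n R)^~ i @^-1` `[tnth a i, tnth b i])).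
  apply: fin_bigcap_measurable; first exact: finite_finset.
  move=> i _; rewrite -[X in measurable X]setTI.
  exact: measurable_tnth.
rewrite predeqE => s; split=> [h i _|h i]; first by rewrite /= in_itv/= h.
by have := h i Logic.I; rewrite /= in_itv.
Qed.

Definition tratr (q : n.-tuple rat) : n.-tuple R := [tuple ratr (tnth q i) | i < n].

Lemma tnth_tratr (q : n.-tuple rat) i : tnth (tratr q) i = ratr (tnth q i).
Proof. by rewrite tnth_mktuple. Qed.

Lemma tratr_between (a b : 'I_n -> R) : (forall i, a i < b i) ->
  exists q, forall i, a i < tnth (tratr q) i < b i.
Proof.
move=> ab; have h i := cid (rat_in_itvoo (ab i)).
exists [tuple sval (h i) | i < n] => i; rewrite tnth_tratr tnth_mktuple.
by have := svalP (h i); rewrite in_itv.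
Qed.

Lemma tratr_dense t (d : R) : 0 < d ->
  exists q, forall i, `|tnth (tratr q) i - tnth t i| < d.
Proof.
move=> d0; have [q hq] := @tratr_between (fun i => tnth t i - d)
  (fun i => tnth t i + d) (fun i => ltac:(by rewrite ltrD2l gtrN)).
exists q => i; rewrite ltr_distl; exact: hq.
Qed.

(** Every point of [U] lies in a box with rational corners contained in [U], and there are only
    countably many such boxes. *)
Lemma topen_measurable U : topen U -> measurable U.
Proof.
move=> oU.
pose B (p : n.-tuple rat * n.-tuple rat) := box (tratr p.1) (tratr p.2).
rewrite [X in measurable X](_ : _ =
  \bigcup_p (if `[< B p `<=` U >] then B p else set0)); last first.
  rewrite predeqE => t; split => [Ut|[p _]]; last by case: asboolP => // + Bt; apply.
  have [d d0 hd] := oU t Ut.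
  have [q hq] := @tratr_between (fun i => tnth t i - d) (tnth t)
     (fun i => ltac:(by rewrite ltrBlDr ltrDl)).
  have [r hr] := @tratr_between (tnth t) (fun i => tnth t i + d)
     (fun i => ltac:(by rewrite ltrDl)).
  exists (q, r) => //; case: asboolP => [_ i|] /=.
    by have /andP[_ /ltW->] := hq i; have /andP[/ltW-> _] := hr i.
  case=> s Bs; apply: hd => i; rewrite ltr_distl.
  have /andP[q1 _] := hq i; have /andP[_ r1] := hr i; have /andP[s1 s2] := Bs i.
  by rewrite (lt_le_trans q1 s1) (le_lt_trans s2 r1).
apply: countable_bigcupT_measurable => [|p]; first exact: countableP.
by case: asboolP => _; [exact: measurable_box|exact: measurable0].
Qed.

Lemma measurable_pos_orthant : measurable (@pos_orthant R n).
Proof. by apply: topen_measurable; exact: topen_pos_orthant. Qed.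

Lemma measurable_lower_orthant t : measurable (lower_orthant t).
Proof. by apply: topen_measurable; exact: topen_lower_orthant. Qed.

End TupleBorel.

(** * Measurability from strict level sets *)

Section MeasurableFun.
Context {d} {T : measurableType d} {R : realType}.

Lemma measurable_fun_lt_level (D : set T) (f : T -> R) :
  (forall a, measurable (D `&` [set x | f x < a])) -> measurable_fun D f.
Proof.
move=> h mD; apply: (measurability _ (RGenInftyO.measurableE R)) => //.
move=> _ [_ [a ->] <-]; rewrite [X in measurable X](_ : _ = D `&` [set x | f x < a])//.
Qed.

Lemma emeasurable_fun_gt_level (D : set T) (f : T -> \bar R) :
  (forall a : R, measurable (D `&` [set x | (a%:E < f x)%E])) -> measurable_fun D f.
Proof.
move=> h mD; apply: (measurability _ (ErealGenOInfty.measurableE R)) => //.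
move=> _ [_ [a ->] <-]; rewrite [X in measurable X](_ : _ = D `&` [set x | (a%:E < f x)%E])//.
by congr (_ `&` _); rewrite predeqE => x/=; rewrite in_itv/= andbT.
Qed.

End MeasurableFun.

(** * Operator families and reflections of Lebesgue measure *)

Section OperatorFamily.
Context {R : realType} {n : nat} {X Y : normedModType R[i]}.
Context (Rop : n.-tuple R -> {linear X -> Y}).
Context (Rop_sc : strongly_continuous (fun t => (Rop t : X -> Y))).

(** The operator norm is a supremum of the functions [nrm (Rop u x)], each continuous on the
    orthant. It is therefore lower semicontinuous and its strict superlevel sets are open. *)
Lemma measurable_opnorm :
  measurable_fun (@pos_orthant R n) (fun u => opnorm (Rop u)).
Proof.
apply: emeasurable_fun_gt_level => a; apply: topen_measurable => t [t0 /=].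
rewrite {1}/opnorm => /ereal_sup_gt[_ [x /= x1 <-]]; rewrite lte_fin => ax.
have e0 : 0 < nrm (Rop t x) - a by rewrite subr_gt0.
have [d1 d10 h1] := topen_pos_orthant t0.
have [d2 d20 h2] := Rop_sc x t0 e0.
exists (Num.min d1 d2); first by rewrite lt_min d10.
move=> s hs; have sp : pos_orthant s.
  by apply: h1 => i; have := hs i; rewrite lt_min => /andP[].
split => //=; apply: (@lt_le_trans _ _ (nrm (Rop s x))%:E).
  have := h2 s sp; have hs2 i : `|tnth s i - tnth t i| < d2.
    by have := hs i; rewrite lt_min => /andP[].
  move=> /(_ hs2); rewrite lte_fin nrm_distC => h.
  have := le_lt_trans (ler_norm _) (le_lt_trans (ler_nrmB_dist _ _) h).
  by rewrite ltrD2l ltrN2.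
by rewrite /opnorm; apply: ereal_sup_ubound; exists x.
Qed.

Context (Rop_bd : forall t, pos_orthant t -> bounded_op (Rop t)).
Context (g : n.-tuple R -> X).
Context (g_cont : tcontinuous g).

Let opn u := fine (opnorm (Rop u)).

Let nrm_op_le u x : pos_orthant u -> nrm (Rop u x) <= opn u * nrm x.
Proof. by move=> /Rop_bd/opnorm_fin_num; exact: nrm_le_opnorm. Qed.

Let opn_ge0 u : 0 <= opn u.
Proof. exact/fine_ge0/opnorm_ge0. Qed.

(* Neither joint continuity nor Banach-Steinhaus is needed: every sublevel set
   is a countable union of countable intersections of open sets. *)
Lemma measurable_nrm_apply (v : Y) :
  measurable_fun (@pos_orthant R n) (fun u => nrm (Rop u (g u) - v)).
Proof.
apply: measurable_fun_lt_level => a.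
(* The vector [x] is a frozen substitute for [g u]: for fixed [x] both conditions are open in [u].
   The slack [m.+1%:R^-1] leaves room for the error of this substitution. *)
pose U (m k : nat) := [set u | pos_orthant u /\ exists x, nrm (g u - x) < k.+1%:R^-1 /\
   nrm (Rop u x - v) < a - m.+1%:R^-1].
rewrite [X in measurable X](_ : _ = \bigcup_m \bigcap_k U m k); last first.
  rewrite predeqE => u; split => [[u0 /= ua]|[m _ hm]].
    have := ua; rewrite -subr_gt0 => /ltr_add_invr; rewrite /= => -[m hm].
    exists m => // k _; split => //; exists (g u); rewrite subrr nrm0 invr_gt0 ltr0n.
    by split => //; rewrite ltrBrDr addrC -ltrBrDr; move: hm; rewrite add0r.
  have u0 : pos_orthant u by case: (hm 0%N Logic.I).
  (* The index [k] may depend on [u] through the norm of [Rop u], because [u] lies in [U m k] for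
     all [k]. *)
  split => //=; have [k hk] : exists k : nat, opn u * k.+1%:R^-1 < m.+1%:R^-1.
    exists (Num.truncn (opn u * m.+1%:R)).
    rewrite ltr_pdivrMr ?ltr0n// mulrC ltr_pdivlMr ?ltr0n//.
    by rewrite truncnS_gt.
  have [_ [x [gx xv]]] := hm k Logic.I.
  rewrite (le_lt_trans (ler_nrm_distD (Rop u x) _ _))//.
  rewrite -(subrK m.+1%:R^-1 a) addrC ltrD// -linearB.
  rewrite (le_lt_trans _ hk)// (le_trans (nrm_op_le _ u0))//.
  by rewrite ler_wpM2l// ltW.
apply: bigcup_measurable => m _; apply: bigcap_measurable => // k _.
apply: topen_measurable => u [u0 [x [gx xv]]].
have [d1 d10 h1] := topen_pos_orthant u0.
have e2 : 0 < k.+1%:R^-1 - nrm (g u - x) by rewrite subr_gt0.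
have [d2 d20 h2] := g_cont u e2.
have e3 : 0 < a - m.+1%:R^-1 - nrm (Rop u x - v) by rewrite subr_gt0.
have [d3 d30 h3] := Rop_sc x u0 e3.
exists (Num.min d1 (Num.min d2 d3)); first by rewrite !lt_min d10 d20.
move=> s hs.
have hs1 i : `|tnth s i - tnth u i| < d1 by have := hs i; rewrite !lt_min => /and3P[].
have hs2 i : `|tnth s i - tnth u i| < d2 by have := hs i; rewrite !lt_min => /and3P[].
have hs3 i : `|tnth s i - tnth u i| < d3 by have := hs i; rewrite !lt_min => /and3P[].
have s0 := h1 _ hs1; split => //; exists x; split.
  by rewrite (le_lt_trans (ler_nrm_distD (g u) _ _))// -ltrBrDr h2.
by rewrite (le_lt_trans (ler_nrm_distD (Rop u x) _ _))// -ltrBrDr h3.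
Qed.

(** The vectors [Rop p (g q)] with rational [p] and [q] suffice. The point [q] is chosen before [p],
    since the radius given by strong continuity depends on the vector [g q]; and [p] must also fall
    in the orthant. *)
Lemma separable_apply : exists w : nat -> Y, forall u, pos_orthant u ->
  forall e, 0 < e -> exists j, nrm (Rop u (g u) - w j) < e.
Proof.
exists (fun j => if unpickle j is Some (p, q) then
   Rop (tratr (p : n.-tuple rat)) (g (tratr (q : n.-tuple rat))) else 0).
move=> u u0 e e0.
have c0 : 0 < opn u + 1 by rewrite ltr_wpDl.
have e1 : 0 < e / 2 / (opn u + 1) by rewrite !divr_gt0.
have [d hd0 hd] := g_cont u e1.
have [q hq] := tratr_dense u hd0.
have e2 : 0 < e / 2 by rewrite divr_gt0.
have [d1 d10 h1] := topen_pos_orthant u0.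
have [d2 d20 h2] := Rop_sc (g (tratr q)) u0 e2.
have [p hp] := @tratr_dense R n u (Num.min d1 d2) ltac:(by rewrite lt_min d10).
exists (pickle (p, q)); rewrite pickleK.
rewrite (le_lt_trans (ler_nrm_distD (Rop u (g (tratr q))) _ _))//.
rewrite (splitr e) ltrD//.
  rewrite -linearB (le_lt_trans (nrm_op_le _ u0))// nrm_distC.
  have := hd _ hq; rewrite ltr_pdivlMr// mulrC; apply: le_lt_trans.
  by rewrite ler_wpM2r ?nrm_ge0// lerDl.
rewrite nrm_distC; apply: h2 => [|i].
  by apply: h1 => i; have := hp i; rewrite lt_min => /andP[].
by have := hp i; rewrite lt_min => /andP[].
Qed.
End OperatorFamily.

Section Continuity.
Context {R : realType} {n : nat} {V : normedModType R[i]}.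

Lemma measurable_nrm_tcontinuous (g : n.-tuple R -> V) (D : set (n.-tuple R)) :
  tcontinuous g -> measurable D -> measurable_fun D (fun u => nrm (g u)).
Proof.
move=> gc mD; apply: measurable_funS (@measurableT _ _) (@subsetT _ _) _.
apply: measurable_fun_lt_level => a; rewrite setTI.
apply: topen_measurable => u /= ua.
have [d d0 hd] := gc u (a - nrm (g u)) ltac:(by rewrite subr_gt0).
exists d => // s /hd; rewrite ltrBrDr; apply: le_lt_trans.
by rewrite (le_trans _ (ler_nrmD _ _))// subrK.
Qed.

Lemma tcontinuousB (g h : n.-tuple R -> V) :
  tcontinuous g -> tcontinuous h -> tcontinuous (fun u => g u - h u).
Proof.
move=> gc hc u e e0; have e2 : 0 < e / 2 by rewrite divr_gt0.
have [d1 d10 h1] := gc u _ e2; have [d2 d20 h2] := hc u _ e2.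
exists (Num.min d1 d2); first by rewrite lt_min d10.
move=> s hs; rewrite opprD opprK addrACA (le_lt_trans (ler_nrmD _ _))//.
rewrite (splitr e) ltrD//.
  by apply: h1 => i; have := hs i; rewrite lt_min => /andP[].
rewrite addrC nrm_distC h2// => i.
by have := hs i; rewrite lt_min => /andP[].
Qed.

End Continuity.

(** * Reflections and the invariance of Lebesgue measure *)

Section Reflection.
Context {R : realType} {n : nat}.
Implicit Types s t u a b : n.-tuple R.

Lemma tnth_tsub t u i : tnth (tsub t u) i = tnth t i - tnth u i.
Proof. by rewrite tnth_mktuple. Qed.

Lemma tnth_tadd t u i : tnth (tadd t u) i = tnth t i + tnth u i.
Proof. by rewrite tnth_mktuple. Qed.

Lemma tsubK t : involutive (tsub t).
Proof. by move=> u; apply: eq_from_tnth => i; rewrite !tnth_tsub subKr. Qed.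

Lemma tcontinuous_reflect (V : normedModType R[i]) (f : n.-tuple R -> V) t :
  tcontinuous f -> tcontinuous (f \o tsub t).
Proof.
move=> fc u e e0; have [d d0 hd] := fc (tsub t u) e e0.
exists d => // s hs; apply: hd => i; rewrite !tnth_tsub.
by rewrite opprB addrC subrKA distrC.
Qed.

Lemma preimage_tsub_lower t : tsub t @^-1` lower_orthant t = @pos_orthant R n.
Proof.
rewrite predeqE => u; split => h i; have := h i; rewrite ?tnth_tsub.
  by rewrite gtrBl.
by rewrite gtrBl.
Qed.

Lemma preimage_tsub_pos t : tsub t @^-1` @pos_orthant R n = lower_orthant t.
Proof. by rewrite -(preimage_tsub_lower t) predeqE => u; rewrite /= tsubK. Qed.

Lemma preimage_tsub_box t a b :
  tsub t @^-1` box a b = box (tsub t b) (tsub t a).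
Proof.
rewrite predeqE => u; split => h i; have := h i; rewrite /= !tnth_tsub.
  by rewrite !lerBrDr !lerBlDr andbC (addrC (tnth b i)) (addrC (tnth a i)).
by rewrite !lerBrDr !lerBlDr andbC (addrC (tnth b i)) (addrC (tnth a i)).
Qed.

Lemma measurable_tsub t : measurable_fun setT (tsub t).
Proof.
apply/measurable_fun_tnthP => i.
rewrite (_ : _ \o _ = (fun u => tnth t i - tnth u i)); last first.
  by apply/funext => u /=; rewrite tnth_tsub.
by apply: measurable_funB => //; exact: measurable_tnth.
Qed.

(** An exhaustion by sets of finite measure, used both for the uniqueness of measures and to keep
    the pieces of the approximating simple functions of finite measure. *)
Definition cube (k : nat) : set (n.-tuple R) :=
  box [tuple - k%:R | _ < n] [tuple k%:R | _ < n].

Lemma cube_absP k u : (forall i, `|tnth u i| <= k%:R) -> cube k u.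
Proof. by move=> h i; rewrite !tnth_mktuple -ler_norml h. Qed.

Lemma cube_nat_bound u : exists k, forall l, (k <= l)%N -> cube l u.
Proof.
exists (\max_(i < n) (Num.truncn `|tnth u i|).+1) => l kl; apply: cube_absP => i.
rewrite (le_trans (ltW (truncnS_gt _)))// ler_nat (leq_trans _ kl)//.
exact: (leq_bigmax (F := fun i => (Num.truncn `|tnth u i|).+1)).
Qed.

Lemma bigcup_cube : \bigcup_k cube k = setT.
Proof.
rewrite predeqE => u; split => // _; have [k hk] := cube_nat_bound u.
by exists k => //; exact: hk.
Qed.

Definition boxes : set (set (n.-tuple R)) := [set B | exists a b, B = box a b].

Lemma boxes_setI : setI_closed boxes.
Proof.
move=> _ _ [a [b ->]] [a' [b' ->]].
exists [tuple Num.max (tnth a i) (tnth a' i) | i < n].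
exists [tuple Num.min (tnth b i) (tnth b' i) | i < n].
rewrite predeqE => u; split => [[h1 h2] i|h].
  by rewrite !tnth_mktuple ge_max le_min; have /andP[-> ->] := h1 i;
    have /andP[-> ->] := h2 i.
by split => i; have := h i; rewrite !tnth_mktuple ge_max le_min =>
  /andP[/andP[? ?] /andP[? ?]]; apply/andP.
Qed.

(** For the inclusion of Borel sets it is enough that each coordinate is measurable for the
    sigma-algebra of the boxes. The half-space where the [i]-th coordinate is at least [a] is the
    union over [k] of the boxes with [i]-th side from [a] to [k] and all other sides from [-k] to
    [k]. *)
Lemma measurable_tupleE :
  @measurable _ (n.-tuple R) = <<s boxes >>.
Proof.
apply/seteqP; split; last first.
  apply: smallest_sub; first exact: sigma_algebra_measurable.
  by move=> _ [a [b ->]]; exact: measurable_box.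
have idm : measurable_fun setT (id : g_sigma_algebraType boxes -> n.-tuple R).
  apply/measurable_fun_tnthP => i _.
  apply: (measurability _ (RGenCInfty.measurableE R)) => //.
  move=> _ [_ [a ->] <-]; rewrite setTI.
  rewrite [X in measurable X](_ : _ = \bigcup_(k : nat)
     box [tuple if j == i then a else - k%:R | j < n] [tuple k%:R | j < n]); last first.
    rewrite predeqE => u; split => /= [|[k _ /(_ i)]].
      rewrite in_itv/= andbT => ua; have [k hk] := cube_nat_bound u.
      exists k => // j; rewrite !tnth_mktuple.
      have := hk _ (leqnn k) j; rewrite !tnth_mktuple => /andP[h ->]; rewrite andbT.
      by case: eqP => // ->.
    by rewrite !tnth_mktuple eqxx in_itv/= andbT => /andP[].
  apply: bigcup_measurable => k _; apply: sub_sigma_algebra.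
  by exists [tuple if j == i then a else - k%:R | j < n], [tuple k%:R | j < n].
by move=> A mA; have := idm measurableT A mA; rewrite setTI.
Qed.

Context (mu : {measure set (n.-tuple R) -> \bar R}).
Context (mu_leb : is_lebesgue_n mu).

Lemma box_set0 a b i : tnth b i < tnth a i -> box a b = set0.
Proof.
move=> ba; rewrite predeqE => u; split => // /(_ i) /andP[au ub].
by have := le_lt_trans (le_trans au ub) ba; rewrite ltxx.
Qed.

Lemma lebesgue_box_lty a b : (mu (box a b) < +oo)%E.
Proof.
have [ab|] := pselect (forall i, tnth a i <= tnth b i).
  by rewrite mu_leb// ltry.
by move=> /existsNP[i /negP]; rewrite -ltNge => /box_set0 ->; rewrite measure0.
Qed.

(** A reflection exchanges the two corners of a box and keeps its side lengths, so [mu] and its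
    image measure agree on boxes. These are stable under intersection, generate the Borel sets, and
    contain the cubes, which have finite measure and exhaust the space. *)
Lemma lebesgue_reflect t A : measurable A -> mu (tsub t @^-1` A) = mu A.
Proof.
move=> mA.
have mt := measurable_tsub t.
pose nu : {measure set _ -> \bar R} :=
  measure_function_pushforward__canonical__measure_function_Measure mu mt.
apply: (@measure_unique _ _ _ boxes cube measurable_tupleE boxes_setI _ bigcup_cube
  nu mu) => //.
- by move=> k; do 2 eexists; reflexivity.
- move=> B [a [b ->]]; rewrite /nu/= /pushforward.
  have [ab|] := pselect (forall i, tnth a i <= tnth b i).
    rewrite preimage_tsub_box !mu_leb//.
      by congr EFin; apply: eq_bigr => i _; rewrite !tnth_tsub opprB addrC subrKA.
    by move=> i; rewrite !tnth_tsub lerD2l lerN2.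
  move=> /existsNP[i /negP]; rewrite -ltNge => /box_set0 ->.
  by rewrite preimage_set0 !measure0.
- by move=> k; rewrite /nu/= /pushforward preimage_tsub_box lebesgue_box_lty.
Qed.

Lemma ge0_integral_reflect t D (h : n.-tuple R -> \bar R) :
  measurable D -> measurable_fun D h -> (forall s, D s -> (0 <= h s)%E) ->
  (\int[mu]_(s in D) h s = \int[mu]_(u in tsub t @^-1` D) h (tsub t u))%E.
Proof.
move=> mD mh h0.
rewrite -(ge0_integral_pushforward (measurable_tsub t) mu mD mh); last first.
  by move=> s; rewrite inE; exact: h0.
pose nu : {measure set _ -> \bar R} :=
  measure_function_pushforward__canonical__measure_function_Measure mu (measurable_tsub t).
apply: (@eq_measure_integral _ _ _ D nu mu) => A mA _.
by rewrite -[LHS](lebesgue_reflect t mA).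
Qed.

End Reflection.

(** * Integrals of simple functions *)

Section SimpleFunctions.
Context {R : realType} {n : nat} {V : normedModType R[i]}.
Context (mu : {measure set (n.-tuple R) -> \bar R}).
Implicit Types (D E : set (n.-tuple R)) (g : n.-tuple R -> V) (v w : V).

Lemma simple_fun_recl m (A : 'I_m.+1 -> set (n.-tuple R)) (y : 'I_m.+1 -> V) s :
  simple_fun A y s = (if `[< A ord0 s >] then y ord0 else 0) +
    simple_fun (A \o lift ord0) (y \o lift ord0) s.
Proof. by rewrite /simple_fun big_ord_recl. Qed.

Lemma simple_int_recl D m (A : 'I_m.+1 -> set (n.-tuple R)) (y : 'I_m.+1 -> V) :
  simple_int mu D A y = (fine (mu (A ord0 `&` D)))%:C%C *: y ord0 +
    simple_int mu D (A \o lift ord0) (y \o lift ord0).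
Proof. by rewrite /simple_int big_ord_recl. Qed.

(** Only distances from [g] to fixed vectors are known to be measurable. The offset [w] makes the
    induction run: on the first piece its value is absorbed into [w]. *)
Lemma measurable_nrm_sub_simple D g m (A : 'I_m -> set (n.-tuple R))
    (y : 'I_m -> V) :
  measurable D -> (forall w, measurable_fun D (fun s => nrm (g s - w))) ->
  (forall i, measurable (A i)) ->
  forall w, measurable_fun D (fun s => nrm (g s - (w + simple_fun A y s))).
Proof.
move=> mD mg; elim: m => [|m IH] in A y * => mA w.
  apply: eq_measurable_fun (mg w) => s _.
  by rewrite /simple_fun big_ord0 addr0.
rewrite (_ : (fun s => _) = (fun s => if `[< A ord0 s >]
   then nrm (g s - ((w + y ord0) + simple_fun (A \o lift ord0) (y \o lift ord0) s))
   else nrm (g s - (w + simple_fun (A \o lift ord0) (y \o lift ord0) s)))); last first.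
  apply/funext => s; rewrite simple_fun_recl addrA.
  by case: ifP => // _; rewrite addr0.
have mA' i : measurable ((A \o lift ord0) i) by exact: mA.
apply: measurable_fun_if => //.
- apply: (@measurable_fun_bool _ _ _ _ true).
  rewrite (_ : _ `&` _ = D `&` A ord0); first exact: measurableI.
  by rewrite predeqE => s; split => -[Ds /=]; [move/asboolP|move=> ?; split => //; exact/asboolP].
- by apply: measurable_funS (IH _ (y \o lift ord0) mA' (w + y ord0)) => // s [].
- by apply: measurable_funS (IH _ (y \o lift ord0) mA' w) => // s [].
Qed.

Lemma measurable_nrm_simple D m (A : 'I_m -> set (n.-tuple R)) (y : 'I_m -> V) w :
  measurable D -> (forall i, measurable (A i)) ->
  measurable_fun D (fun s => nrm (w + simple_fun A y s)).
Proof.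
move=> mD mA; have := @measurable_nrm_sub_simple D (fun=> 0) m A y mD
  (fun w => measurable_cst (nrm (0 - w))) mA w.
by apply: eq_measurable_fun => s _; rewrite sub0r nrmN.
Qed.

Lemma simple_int_setID D m (A : 'I_m -> set (n.-tuple R)) (y : 'I_m -> V) B :
  measurable D -> measurable B ->
  (forall i, measurable (A i) /\ (mu (A i) < +oo)%E) ->
  simple_int mu D A y = simple_int mu (D `&` B) A y + simple_int mu (D `\` B) A y.
Proof.
move=> mD mB hA; rewrite /simple_int -big_split/=; apply: eq_bigr => i _.
have [mA Afin] := hA i.
have fin C : measurable C -> mu (A i `&` C) \is a fin_num.
  move=> mC; rewrite ge0_fin_numE//; apply: le_lt_trans Afin.
  by apply: le_measure; rewrite ?inE//; exact: measurableI.
have mI := measurableI _ _ mD mB; have mD' := measurableD mD mB.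
rewrite -scalerDl -rmorphD -fineD ?fin//; congr (_%:C%C *: _); congr fine.
rewrite -measureU; last 3 first.
- exact: measurableI.
- exact: measurableI.
- by rewrite predeqE => s; split => // -[[_ [_ Bs]] [_ [_ /(_ Bs)]]].
by rewrite -setIUr setUIDK.
Qed.

(* Induction on the number of pieces, splitting the domain along the first one:
   this copes with overlapping pieces. *)
Lemma nrm_offset_simple_int_le m (A : 'I_m -> set (n.-tuple R)) (y : 'I_m -> V) :
  (forall i, measurable (A i) /\ (mu (A i) < +oo)%E) ->
  forall E w, measurable E -> (w != 0 -> (mu E < +oo)%E) ->
  ((nrm ((fine (mu E))%:C%C *: w + simple_int mu E A y))%:E <=
     \int[mu]_(s in E) (nrm (w + simple_fun A y s))%:E)%E.
Proof.
elim: m => [|m IH] in A y * => hA E w mE wE.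
  under eq_integral do rewrite /simple_fun big_ord0 addr0.
  rewrite /simple_int big_ord0 addr0 nrmZ integral_cst//.
  (* If [E] has infinite measure then [w = 0] and both sides vanish. *)
  have [->|/wE Efin] := eqVneq w 0; first by rewrite nrm0 mulr0 mul0e.
  by rewrite ger0_norm ?fine_ge0// EFinM fineK ?ge0_fin_numE// muleC.
pose A' := A \o lift ord0; pose y' := y \o lift ord0.
have [mA0 A0fin] := hA ord0.
have hA' i : measurable (A' i) /\ (mu (A' i) < +oo)%E by exact: hA.
have mI : measurable (E `&` A ord0) by exact: measurableI.
have mD : measurable (E `\` A ord0) by exact: measurableD.
have Ifin : (mu (E `&` A ord0) < +oo)%E.
  by apply: le_lt_trans A0fin; apply: le_measure; rewrite ?inE.
have Dfin : w != 0 -> (mu (E `\` A ord0) < +oo)%E.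
  by move=> /wE; apply: le_lt_trans; apply: le_measure; rewrite ?inE.
have mf F : measurable F ->
    measurable_fun F (fun s => (nrm (w + simple_fun A y s))%:E).
  by move=> mF; apply/measurable_EFinP; apply: measurable_nrm_simple => // i; case: (hA i).
have EE : (E `&` A ord0) `|` (E `\` A ord0) = E by rewrite setUIDK.
rewrite -[X in (_ <= integral _ X _)%E]EE ge0_integral_setU//; last 3 first.
- by rewrite EE; exact: mf.
- by move=> s _; rewrite lee_fin nrm_ge0.
- by apply/disj_setPS => s [[_ a] [_ /(_ a)]].
rewrite (@eq_integral _ _ _ _ (E `&` A ord0)
  (fun s => (nrm ((w + y ord0) + simple_fun A' y' s))%:E)); last first.
  move=> s; rewrite inE => -[_ As]; rewrite simple_fun_recl.
  by case: asboolP => // _; rewrite addrA.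
rewrite (@eq_integral _ _ _ _ (E `\` A ord0)
  (fun s => (nrm (w + simple_fun A' y' s))%:E)); last first.
  move=> s; rewrite inE => -[_ As]; rewrite simple_fun_recl.
  by case: asboolP => // _; rewrite add0r.
(* Inside the first piece the offset becomes [w + y ord0], possibly nonzero, but the measure there
   is finite; outside it the offset is still [w]. *)
apply: le_trans (leeD (IH A' y' hA' _ (w + y ord0) mI (fun=> Ifin))
                      (IH A' y' hA' _ w mD Dfin)).
rewrite -EFinD lee_fin (le_trans _ (ler_nrmD _ _))// le_eqVlt; apply/orP; left; apply/eqP.
congr nrm; rewrite simple_int_recl (simple_int_setID y' mE mA0 hA').
have -> : (fine (mu E))%:C%C *: w = (fine (mu (E `&` A ord0)))%:C%C *: w +
    (fine (mu (E `\` A ord0)))%:C%C *: w.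
  have [->|w0] := eqVneq w 0; first by rewrite !scaler0 addr0.
  rewrite -scalerDl -rmorphD -fineD ?ge0_fin_numE ?Dfin//.
  rewrite -{1}EE measureU//.
  by rewrite predeqE => s; split => // -[[_ a] [_ /(_ a)]].
rewrite scalerDr (setIC (A ord0)) -!addrA; congr (_ + _).
by rewrite [LHS]addrCA; congr (_ + _); exact: addrCA.
Qed.

Lemma nrm_simple_int_le D m (A : 'I_m -> set (n.-tuple R)) (y : 'I_m -> V) :
  measurable D -> (forall i, measurable (A i) /\ (mu (A i) < +oo)%E) ->
  ((nrm (simple_int mu D A y))%:E <= \int[mu]_(s in D) (nrm (simple_fun A y s))%:E)%E.
Proof.
move=> mD hA; have := @nrm_offset_simple_int_le m A y hA D 0 mD.
rewrite eqxx scaler0 add0r => /(_ (fun h => ltac:(by []))).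
by under eq_integral do rewrite add0r.
Qed.

(** Concatenating the two families, with the values of the second negated, presents the difference
    as one simple function. Its pieces overlap in general, which the previous estimate allows. *)
Lemma nrm_simple_intB_le D m m' (A : 'I_m -> set (n.-tuple R)) (y : 'I_m -> V)
    (A' : 'I_m' -> set (n.-tuple R)) (y' : 'I_m' -> V) :
  measurable D -> (forall i, measurable (A i) /\ (mu (A i) < +oo)%E) ->
  (forall i, measurable (A' i) /\ (mu (A' i) < +oo)%E) ->
  ((nrm (simple_int mu D A y - simple_int mu D A' y'))%:E <=
   \int[mu]_(s in D) (nrm (simple_fun A y s - simple_fun A' y' s))%:E)%E.
Proof.
move=> mD hA hA'.
pose B (i : 'I_(m + m')) := match fintype.split i with inl j => A j | inr j => A' j end.
pose z (i : 'I_(m + m')) := match fintype.split i with inl j => y j | inr j => - y' j end.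
have hB i : measurable (B i) /\ (mu (B i) < +oo)%E.
  by rewrite /B; case: fintype.split => j; [exact: hA|exact: hA'].
have := nrm_simple_int_le z mD hB.
have -> : simple_int mu D B z = simple_int mu D A y - simple_int mu D A' y'.
  rewrite /simple_int big_split_ord/= -sumrN; congr (_ + _); apply: eq_bigr => i _.
    by rewrite /B /z (unsplitK (inl _ i)).
  by rewrite /B /z (unsplitK (inr _ i)) scalerN.
have zE s : simple_fun B z s = simple_fun A y s - simple_fun A' y' s.
  rewrite /simple_fun big_split_ord/= -sumrN; congr (_ + _); apply: eq_bigr => i _.
    by rewrite /B /z (unsplitK (inl _ i)).
  by rewrite /B /z (unsplitK (inr _ i)); case: ifP; rewrite ?oppr0.
by under eq_integral do rewrite zE.
Qed.

End SimpleFunctions.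

(** * Existence of Bochner integrals *)

Section BochnerIntegral.
Context {R : realType} {n : nat} (mu : {measure set (n.-tuple R) -> \bar R}).
Implicit Types (D : set (n.-tuple R)).

Lemma cvg_nrm0P (V : normedModType R[i]) (u : nat -> V) (v : V) :
  (forall e : R, 0 < e -> exists N, forall k, (N <= k)%N -> nrm (u k - v) < e) ->
  (fun k => nrm (u k - v)) @ \oo --> (0 : R).
Proof.
move=> h; apply/cvgrPdist_lt => e /h[N hN]; exists N => // k /= /hN.
by rewrite sub0r normrN ger0_norm ?nrm_ge0.
Qed.

Lemma cvge0_lt (u : nat -> \bar R) (e : R) : u @ \oo --> (0 : \bar R)%E -> 0 < e ->
  exists N, forall k, (N <= k)%N -> (u k < e%:E)%E.
Proof.
move=> u0 e0; have [N _ hN] : \forall k \near \oo, (u k < e%:E)%E.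
  exact: (u0 _ (@nbhs_open_ereal_lt _ 0 (fun=> e) e0)).
by exists N.
Qed.

(** On [E k], replace [g] by a nearest vector among finitely many. The error tends to 0 pointwise
    and is dominated by the norm of [g], hence tends to 0 in mean; the integrals of the approximants
    are then Cauchy, and completeness of [V] gives the limit. *)
Lemma exists_bochner_integral (V : completeNormedModType R[i]) D
    (g : n.-tuple R -> V) (w : nat -> V) (E : nat -> set (n.-tuple R)) :
  measurable D ->
  (forall k, measurable (E k) /\ (mu (E k) < +oo)%E) ->
  (forall s, exists K, forall k, (K <= k)%N -> E k s) ->
  (forall v, measurable_fun D (fun s => nrm (g s - v))) ->
  (forall s, D s -> forall e : R, 0 < e -> exists j, nrm (g s - w j) < e) ->
  (\int[mu]_(s in D) (nrm (g s))%:E < +oo)%E ->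
  exists v, has_bochner_integral mu D g v.
Proof.
move=> mD hE Ecov mg wdense gfin.
pose v j := if j is j'.+1 then w j' else 0.
pose dist s j := nrm (g s - v j).
(* s belongs to the i-th piece when v i is the first nearest point to g s among
   v 0, ..., v k; since v 0 = 0 the approximation error never exceeds |g s|. *)
pose A k (i : 'I_k.+1) := D `&` E k `&`
   [set s | forall j : 'I_k.+1, dist s i <= dist s j] `&`
   [set s | forall j : 'I_k.+1, (j < i)%N -> dist s i < dist s j].
pose y k (i : 'I_k.+1) := v i.
have mdist j : measurable_fun D (dist ^~ j) by exact: mg.
have mA k i : measurable (A k i).
  rewrite (_ : A k i = E k `&` \bigcap_(j in [set: 'I_k.+1])
      (D `&` [set s | dist s i <= dist s j]) `&`
      \bigcap_(j in [set j : 'I_k.+1 | (j < i)%N])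
        (D `&` [set s | dist s i < dist s j])).
    apply: measurableI; first apply: measurableI; first by case: (hE k).
      apply: fin_bigcap_measurable => [|j _]; first exact: finite_finset.
      exact: (measurable_fun_ler (mdist i) (mdist j) mD (Y := [set true])).
    apply: fin_bigcap_measurable => [|j _]; first exact: finite_finset.
    exact: (measurable_fun_ltr (mdist i) (mdist j) mD (Y := [set true])).
  rewrite predeqE => s; split => [[[[Ds Es] h1] h2]|[[Es h1] h2]].
    by split; [split => // j _; split => //; exact: h1|move=> j ji; split => //; exact: h2].
  have [Ds _] := h1 ord0 Logic.I; split; first by split => // j; case: (h1 j Logic.I).
  by move=> j /h2[].
have Afin k i : measurable (A k i) /\ (mu (A k i) < +oo)%E.
  split=> //; apply: le_lt_trans (proj2 (hE k)); apply: le_measure; rewrite ?inE//.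
    by case: (hE k).
  by move=> s [[[]]].
have nearest s k : D s -> E k s -> exists2 i : 'I_k.+1, A k i s & forall j, A k j s -> j = i.
  move=> Ds Es.
  (* Two minimisations: the least distance, then the least index attaining it. *)
  have [i0 _ hi0] := @arg_minP _ _ _ (ord0 : 'I_k.+1) predT (fun j : 'I_k.+1 => dist s j) isT.
  have [i hi imin] := @arg_minnP _ i0 (fun i : 'I_k.+1 => dist s i == dist s i0)
     (fun i => nat_of_ord i) (eqxx _).
  exists i => [|j [[_ /= j1] j2]].
    split; first by split=> // j /=; rewrite (eqP hi) hi0.
    move=> j /= ji; rewrite (eqP hi) lt_neqAle hi0// andbT eq_sym.
    by apply: contraTneq ji => hj; rewrite -leqNgt imin// hj.
  have ij : dist s i = dist s j.
    apply/eqP; rewrite eq_le j1 andbT; rewrite (eqP hi); exact: hi0.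
  apply/val_inj/eqP; rewrite eqn_leq imin; last by rewrite -ij.
  rewrite andbT leqNgt; apply/negP => /j2/=.
  by rewrite ij ltxx.
have approx s k : D s -> E k s ->
    forall j : 'I_k.+1, nrm (g s - simple_fun (A k) (y k) s) <= dist s j.
  move=> Ds Es j; have [i Ai iu] := nearest s k Ds Es.
  rewrite /simple_fun (bigD1 i)//= big1 => [|j' /negP j'i].
    by case: asboolP => // _; rewrite addr0; case: Ai => -[_ /(_ j)].
  by case: asboolP => // /iu /eqP.
have approx0 s k : D s -> ~ E k s -> simple_fun (A k) (y k) s = 0.
  move=> Ds nEs; rewrite /simple_fun big1// => i _.
  by case: asboolP => // -[[[]]].
have bound s k : D s -> nrm (g s - simple_fun (A k) (y k) s) <= nrm (g s).
  move=> Ds; have [Es|nEs] := pselect (E k s); last by rewrite approx0// subr0.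
  by rewrite (le_trans (approx s k Ds Es ord0))// /dist subr0.
have ptw s : D s -> (fun k => nrm (g s - simple_fun (A k) (y k) s)) @ \oo --> (0 : R).
  move=> Ds; apply/cvgrPdist_lt => e e0; have [j hj] := wdense s Ds e e0.
  (* Since [w j] is [v j.+1], it competes from stage [j.+1] on. *)
  have [K hK] := Ecov s; exists (maxn K j.+1) => // k /=; rewrite geq_max => /andP[Kk jk].
  rewrite sub0r normrN ger0_norm ?nrm_ge0// (le_lt_trans _ hj)//.
  have jk' : (j.+1 < k.+1)%N by [].
  exact: (approx s k Ds (hK k Kk) (Ordinal jk')).
have mdiff k : measurable_fun D (fun s => nrm (g s - simple_fun (A k) (y k) s)).
  have := @measurable_nrm_sub_simple _ _ _ D g _ (A k) (y k) mD mg (mA k) 0.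
  by apply: eq_measurable_fun => s _; rewrite add0r.
have L1 : (fun k => (\int[mu]_(x in D) (nrm (g x - simple_fun (A k) (y k) x))%:E)%E)
       @ \oo --> (0 : \bar R).
  rewrite -(integral0 mu D).
  apply: (@dominated_cvg _ _ _ mu D mD _ _ (fun s => (nrm (g s))%:E)) => //.
  - by move=> k; apply/measurable_EFinP.
  - by move=> s Ds; apply: cvg_EFin; [exact: nearW|exact: ptw].
  - apply/integrableP; split.
      apply/measurable_EFinP; apply: eq_measurable_fun (mg 0) => s _.
      by rewrite subr0.
    by under eq_integral do rewrite gee0_abs ?lee_fin ?nrm_ge0//.
  - by move=> k s Ds; rewrite gee0_abs ?lee_fin ?nrm_ge0// bound.
have [|I hI] := @nrm_complete R V (fun k => simple_int mu D (A k) (y k)).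
  move=> e e0; have e2 : 0 < e / 2 by rewrite divr_gt0.
  have [N hN] := cvge0_lt L1 e2; exists N => k l Nk Nl.
  rewrite -lte_fin (le_lt_trans (nrm_simple_intB_le (y k) (y l) mD (Afin k) (Afin l)))//.
  rewrite (splitr e) EFinD; apply: le_lt_trans (lteD (hN k Nk) (hN l Nl)).
  rewrite -ge0_integralD//; last 4 first.
  - by move=> s _; rewrite lee_fin nrm_ge0.
  - exact/measurable_EFinP.
  - by move=> s _; rewrite lee_fin nrm_ge0.
  - exact/measurable_EFinP.
  apply: ge0_le_integral => //.
  - by move=> s _; rewrite lee_fin nrm_ge0.
  - apply/measurable_EFinP; have := @measurable_nrm_sub_simple _ _ _ D
      (simple_fun (A k) (y k)) _ (A l) (y l) mD _ (mA l) 0.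
    under eq_fun do rewrite add0r; apply => z.
    have := measurable_nrm_simple (y k) (- z) mD (mA k).
    by under eq_fun do rewrite addrC.
  - by apply: emeasurable_funD; apply/measurable_EFinP.
  - move=> s _; rewrite -EFinD lee_fin.
    by rewrite (le_trans (ler_nrm_distD (g s) _ _))// lerD2r nrm_distC.
exists I, (fun k => k.+1), A, y; split; first by move=> k i; exact: Afin.
split; last by split; [exact: L1|exact: cvg_nrm0P].
apply: aeW => s Ds; have := ptw s Ds.
by under eq_fun do rewrite nrm_distC.
Qed.
End BochnerIntegral.

(** * Estimates of Bochner integrals and the convolution *)

Section BochnerIntegralTheory.
Context {R : realType} {n : nat} (mu : {measure set (n.-tuple R) -> \bar R}).
Context {V : normedModType R[i]}.
Implicit Types (D : set (n.-tuple R)) (g : n.-tuple R -> V).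

Lemma measurable_nrm_approx D g m (A : 'I_m -> set (n.-tuple R)) (y : 'I_m -> V) :
  measurable D -> (forall w, measurable_fun D (fun s => nrm (g s - w))) ->
  (forall i, measurable (A i)) ->
  measurable_fun D (fun s => (nrm (g s - simple_fun A y s))%:E).
Proof.
move=> mD mg mA; apply/measurable_EFinP.
have := measurable_nrm_sub_simple y mD mg mA 0.
by under eq_fun do rewrite add0r.
Qed.

(** Pull back the pieces and keep their values: invariance of [mu] preserves null sets, errors in
    mean and the coefficients of the simple integrals. *)
Lemma has_bochner_integral_reflect t D g v : is_lebesgue_n mu -> measurable D ->
  (forall w, measurable_fun D (fun s => nrm (g s - w))) ->
  has_bochner_integral mu D g v ->
  has_bochner_integral mu (tsub t @^-1` D) (g \o tsub t) v.
Proof.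
move=> leb mD mg [m [A [y [hA [[N [mN N0 DN]] [L1 I]]]]]].
have mpre B : measurable B -> measurable (tsub t @^-1` B).
  by move=> mB; rewrite -[X in measurable X]setTI; exact: measurable_tsub.
exists m, (fun k i => tsub t @^-1` A k i), y; split.
  move=> k i; have [mA Afin] := hA k i; split; first exact: mpre.
  by rewrite (lebesgue_reflect leb).
split.
  exists (tsub t @^-1` N); split; [exact: mpre|by rewrite (lebesgue_reflect leb)|].
  by move=> u /= hu; apply: DN => /= h; apply: hu => Du; exact: h.
split.
  apply: cvg_trans L1; apply: near_eq_cvg; near=> k.
  rewrite (ge0_integral_reflect leb t mD)//.
  - by apply: measurable_nrm_approx => // i; case: (hA k i).
  - by move=> s _; rewrite lee_fin nrm_ge0.
apply: cvg_trans I; apply: near_eq_cvg; near=> k; congr (nrm (_ - _)).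
rewrite /simple_int; apply: eq_bigr => i _; congr (_%:C%C *: _); congr fine.
rewrite -preimage_setI (lebesgue_reflect leb)//.
by apply: measurableI => //; case: (hA k i).
Unshelve. all: by end_near. Qed.

(** The two integrals may come from unrelated approximating sequences. In particular [g = g'] and
    [h = 0] give uniqueness of the integral. *)
Lemma nrm_bochner_integralB_le D g g' v v' (h : n.-tuple R -> \bar R) :
  measurable D ->
  (forall w, measurable_fun D (fun s => nrm (g s - w))) ->
  (forall w, measurable_fun D (fun s => nrm (g' s - w))) ->
  measurable_fun D h ->
  (forall s, D s -> ((nrm (g s - g' s))%:E <= h s)%E) ->
  has_bochner_integral mu D g v -> has_bochner_integral mu D g' v' ->
  ((nrm (v - v'))%:E <= \int[mu]_(s in D) h s)%E.
Proof.
move=> mD mg mg' mh hh [m [A [y [hA [_ [L1 I]]]]]] [m' [A' [y' [hA' [_ [L1' I']]]]]].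
apply/lee_addgt0Pr => e e0.
(* Four errors share [e]: for each integrand, the error in mean and that of the simple integral. *)
have e4 : 0 < e / 2 / 2 by rewrite !divr_gt0.
have [N1 h1] := cvge0_lt L1 e4; have [N2 h2] := cvge0_lt L1' e4.
have [N3 _ h3] : \forall k \near \oo, nrm (simple_int mu D (A k) (y k) - v) < e / 2 / 2.
  by apply: cvgr_lt I _ _.
have [N4 _ h4] : \forall k \near \oo, nrm (simple_int mu D (A' k) (y' k) - v') < e / 2 / 2.
  by apply: cvgr_lt I' _ _.
pose k := maxn (maxn N1 N2) (maxn N3 N4).
have k1 : (N1 <= k)%N by rewrite /k !leq_max leqnn.
have k2 : (N2 <= k)%N by rewrite /k !leq_max leqnn orbT.
have k3 : (N3 <= k)%N by rewrite /k !leq_max leqnn !orbT.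
have k4 : (N4 <= k)%N by rewrite /k !leq_max leqnn !orbT.
have {}h1 := h1 k k1; have {}h2 := h2 k k2.
have {}h3 := h3 k k3; have {}h4 := h4 k k4.
have mS : measurable_fun D (fun s => (nrm (g s - simple_fun (A k) (y k) s))%:E).
  by apply: measurable_nrm_approx => // i; case: (hA k i).
have mS' : measurable_fun D (fun s => (nrm (g' s - simple_fun (A' k) (y' k) s))%:E).
  by apply: measurable_nrm_approx => // i; case: (hA' k i).
have h0 s : D s -> (0 <= h s)%E.
  by move=> Ds; apply: le_trans (hh s Ds); rewrite lee_fin nrm_ge0.
have mid : ((nrm (simple_int mu D (A k) (y k) - simple_int mu D (A' k) (y' k)))%:E <=
    \int[mu]_(s in D) h s + (e / 2)%:E)%E.
  apply: (le_trans (nrm_simple_intB_le (y k) (y' k) mD (hA k) (hA' k))).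
  apply: (@le_trans _ _ (\int[mu]_(s in D) (h s +
     ((nrm (g s - simple_fun (A k) (y k) s))%:E +
      (nrm (g' s - simple_fun (A' k) (y' k) s))%:E)))%E).
    apply: ge0_le_integral => //.
    - by move=> s _; rewrite lee_fin nrm_ge0.
    - apply: measurable_nrm_approx => //; last by move=> i; case: (hA' k i).
      move=> w; have := @measurable_nrm_simple R n V D (m k) (A k) (y k) (- w) mD
        (fun i => proj1 (hA k i)).
      by under eq_fun do rewrite addrC.
    - by apply: emeasurable_funD => //; exact: emeasurable_funD.
    - move=> s Ds; apply: le_trans (leeD (hh s Ds) (lexx _)).
      rewrite -!EFinD lee_fin (le_trans (ler_nrm_distD (g s) _ _))//.
      rewrite nrm_distC addrCA lerD2l.
      by rewrite (le_trans (ler_nrm_distD (g' s) _ _))// lerD2l.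
  rewrite ge0_integralD//; last 2 first.
  - by move=> s _; rewrite -EFinD lee_fin addr_ge0 ?nrm_ge0.
  - exact: emeasurable_funD.
  rewrite leeD2l// ge0_integralD//; last 2 first.
  - by move=> s _; rewrite lee_fin nrm_ge0.
  - by move=> s _; rewrite lee_fin nrm_ge0.
  by rewrite (splitr (e / 2)) EFinD ltW// lteD.
apply: (@le_trans _ _ ((nrm (simple_int mu D (A k) (y k) -
    simple_int mu D (A' k) (y' k)))%:E + (e / 2)%:E)%E).
  rewrite -EFinD lee_fin.
  rewrite (le_trans (ler_nrm_distD (simple_int mu D (A k) (y k)) _ _))//.
  rewrite nrm_distC (splitr (e / 2)) addrC addrA lerD//; last exact: ltW.
  rewrite (le_trans (ler_nrm_distD (simple_int mu D (A' k) (y' k)) _ _))//.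
  by rewrite lerD2l ltW.
by rewrite [X in (_ <= _ + X%:E)%E](splitr e) EFinD addeA leeD2r.
Qed.

End BochnerIntegralTheory.

(** * The convolution of the operator family with [f] *)

Section Convolution.
Context {R : realType} {n : nat} {X Y : completeNormedModType R[i]}.
Context (mu : {measure set (n.-tuple R) -> \bar R}).
Context (Rop : n.-tuple R -> {linear X -> Y}) (f : n.-tuple R -> X).
Context (mu_leb : is_lebesgue_n mu).
Context (Rop_bd : forall t, pos_orthant t -> bounded_op (Rop t)).
Context (Rop_sc : strongly_continuous (fun t => (Rop t : X -> Y))).
Context (Rop_int : (\int[mu]_(t in @pos_orthant R n) opnorm (Rop t) < +oo)%E).
Context (M : R).
Context (f_bd : forall s, nrm (f s) <= M).
Context (f_cont : tcontinuous f).

Let pos := @pos_orthant R n.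
Let op u : R := fine (opnorm (Rop u)).

Let op_ge0 u : 0 <= op u.
Proof. exact/fine_ge0/opnorm_ge0. Qed.

Let opE u : pos u -> (op u)%:E = opnorm (Rop u).
Proof. by move=> /Rop_bd/opnorm_fin_num/fineK. Qed.

Let nrm_op_le u x : pos u -> nrm (Rop u x) <= op u * nrm x.
Proof. by move=> /Rop_bd/opnorm_fin_num; exact: nrm_le_opnorm. Qed.

Let mpos : measurable pos. Proof. exact: measurable_pos_orthant. Qed.

Let mop : measurable_fun pos op.
Proof.
apply/measurable_EFinP; apply: eq_measurable_fun (measurable_opnorm Rop_sc).
by move=> u; rewrite inE => /opE.
Qed.

Let op_int : (\int[mu]_(u in pos) (op u)%:E < +oo)%E.
Proof.
by rewrite (eq_integral (fun u => opnorm (Rop u)))// => u; rewrite inE => /opE.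
Qed.

Let op_intZ c : 0 <= c ->
  (\int[mu]_(u in pos) (c * op u)%:E = c%:E * \int[mu]_(u in pos) (op u)%:E)%E.
Proof.
move=> c0; under eq_integral do rewrite EFinM.
by rewrite ge0_integralZl//; [exact/measurable_EFinP|move=> u _; rewrite lee_fin].
Qed.

Let M_ge0 : 0 <= M.
Proof. exact: le_trans (nrm_ge0 _) (f_bd [tuple 0 | _ < n]). Qed.

Let mapply t w : measurable_fun pos (fun u => nrm (Rop u (f (tsub t u)) - w)).
Proof.
exact: (measurable_nrm_apply Rop_sc Rop_bd (tcontinuous_reflect t f_cont)).
Qed.

Let mapply_lower t w :
  measurable_fun (lower_orthant t) (fun s => nrm (Rop (tsub t s) (f s) - w)).
Proof.
rewrite (_ : (fun s => _) = (fun u => nrm (Rop u (f (tsub t u)) - w)) \o tsub t).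
  apply: (measurable_comp mpos) (mapply t w) _.
    by move=> _ [s hs <-]; rewrite -(preimage_tsub_pos t) in hs.
  apply: measurable_funS (measurable_tsub t) => //.
by apply/funext => s /=; rewrite tsubK.
Qed.

(** The integral is built over the positive orthant, where the integrand is dominated by [M * op u],
    and then reflected back to the orthant below [t]. *)
Lemma exists_convolution t : exists v : Y,
  has_bochner_integral mu (lower_orthant t) (fun s => Rop (tsub t s) (f s)) v.
Proof.
have [w hw] := separable_apply Rop_sc Rop_bd (tcontinuous_reflect t f_cont).
have [||||||v hv] := @exists_bochner_integral R n mu Y pos
    (fun u => Rop u (f (tsub t u))) w (@cube R n) => //.
- move=> k; split; first exact: measurable_box.
  exact: lebesgue_box_lty.
- exact: cube_nat_bound.
- exact: mapply.
- apply: (@le_lt_trans _ _ (\int[mu]_(u in pos) (M * op u)%:E)%E).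
    apply: ge0_le_integral => //.
    + by move=> u _; rewrite lee_fin nrm_ge0.
    + by apply/measurable_EFinP; have := mapply t 0; under eq_fun do rewrite subr0.
    + by apply/measurable_EFinP; exact: measurable_funM.
    + move=> u pu; rewrite lee_fin (le_trans (nrm_op_le _ pu))// mulrC.
      by rewrite ler_wpM2r.
  by rewrite op_intZ// lte_mul_pinfty// lee_fin.
exists v; have := has_bochner_integral_reflect t mu_leb mpos (mapply t) hv.
rewrite preimage_tsub_pos.
rewrite (_ : _ \o _ = (fun s => Rop (tsub t s) (f s)))//.
by apply/funext => s /=; rewrite tsubK.
Qed.

Let mdiff t t' : measurable_fun pos
  (fun u => nrm (f (tsub t u) - f (tsub t' u))).
Proof.
apply: measurable_nrm_tcontinuous => //.
by apply: tcontinuousB; exact: tcontinuous_reflect.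
Qed.

Context (F : n.-tuple R -> Y).
Context (hF : forall t, has_bochner_integral mu (lower_orthant t)
                  (fun s => Rop (tsub t s) (f s)) (F t)).

(** After reflection both integrands apply the same [Rop u] on the same domain, so linearity lets
    them be subtracted pointwise. *)
Lemma nrm_convolutionB_le t t' : ((nrm (F t - F t'))%:E <=
  \int[mu]_(u in pos) (op u * nrm (f (tsub t u) - f (tsub t' u)))%:E)%E.
Proof.
have hG s : has_bochner_integral mu pos (fun u => Rop u (f (tsub s u))) (F s).
  have := has_bochner_integral_reflect s mu_leb (measurable_lower_orthant s)
    (@mapply_lower s) (hF s).
  rewrite preimage_tsub_lower.
  rewrite (_ : _ \o _ = (fun u => Rop u (f (tsub s u))))//.
  by apply/funext => u /=; rewrite tsubK.
apply: (nrm_bochner_integralB_le mpos (mapply t) (mapply t') _ _ (hG t) (hG t')).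
  by apply/measurable_EFinP; exact: measurable_funM.
by move=> u pu; rewrite -linearB lee_fin nrm_op_le.
Qed.

(** Dominated convergence concerns sequences, so a failure of continuity is first turned into a
    sequence tending to [t]. The dominating function [(M + M) * op u] replaces a modulus of
    continuity of [f] uniform in [u]. *)
Lemma tcontinuous_convolution : tcontinuous F.
Proof.
move=> t e e0; apply: contrapT => nc.
have {}nc k : exists s, (forall i, `|tnth s i - tnth t i| < k.+1%:R^-1) /\
    e <= nrm (F s - F t).
  apply: contrapT => ns; apply: nc; exists k.+1%:R^-1; first by rewrite invr_gt0 ltr0n.
  move=> s hs; rewrite ltNge; apply/negP => es; apply: ns; by exists s.
have [s hs] := choice nc.
have : (fun k => \int[mu]_(u in pos)
    (op u * nrm (f (tsub (s k) u) - f (tsub t u)))%:E)%E @ \oo --> (0 : \bar R).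
  rewrite -(integral0 mu pos).
  apply: (@dominated_cvg _ _ _ mu pos mpos _ _ (fun u => ((M + M) * op u)%:E)) => //.
  - by move=> k; apply/measurable_EFinP; exact: measurable_funM.
  - move=> u pu; apply: cvg_EFin; first exact: nearW.
    rewrite -(mulr0 (op u)); apply: cvgMr.
    apply/cvgrPdist_lt => r r0; have [d d0 hd] := f_cont (tsub t u) r0.
    (* From this index on [k.+1] exceeds [d^-1], so [s k] is within [d] of [t]. *)
    exists (Num.truncn d^-1) => // k /= Nk.
    rewrite sub0r normrN ger0_norm ?nrm_ge0//; apply: hd => i.
    rewrite !tnth_tsub opprB addrA subrK.
    apply: lt_le_trans (proj1 (hs k) i) _.
    rewrite invf_ple ?posrE ?ltr0n// (le_trans (ltW (truncnS_gt _)))//.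
    by rewrite ler_nat ltnS.
  - apply/integrableP; split; first by apply/measurable_EFinP; exact: measurable_funM.
    under eq_integral do rewrite gee0_abs ?lee_fin ?mulr_ge0 ?addr_ge0//.
    by rewrite op_intZ ?addr_ge0// lte_mul_pinfty// lee_fin addr_ge0.
  - move=> k u pu; rewrite gee0_abs ?lee_fin ?mulr_ge0 ?nrm_ge0// mulrC ler_wpM2r//.
    by rewrite (le_trans (ler_nrmD _ _))// nrmN lerD.
move=> /cvge0_lt/(_ e0)[N /(_ N (leqnn N))].
rewrite ltNge => /negP; apply.
by apply: le_trans (nrm_convolutionB_le _ _); rewrite lee_fin; case: (hs N).
Qed.

Lemma nrm_convolution_unif_le t t' (r : R) : 0 <= r ->
  (forall u, nrm (f (tsub t u) - f (tsub t' u)) <= r) ->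
  nrm (F t - F t') <= r * fine (\int[mu]_(u in pos) (op u)%:E)%E.
Proof.
move=> r0 hr; rewrite -lee_fin EFinM fineK; last first.
  by rewrite ge0_fin_numE// integral_ge0// => u _; rewrite lee_fin.
rewrite -op_intZ//; apply: le_trans (nrm_convolutionB_le _ _) _.
apply: ge0_le_integral => //.
- by move=> u _; rewrite lee_fin mulr_ge0 ?nrm_ge0.
- by apply/measurable_EFinP; exact: measurable_funM.
- by apply/measurable_EFinP; exact: measurable_funM.
- by move=> u pu; rewrite lee_fin mulrC ler_wpM2r.
Qed.

Lemma multi_ap_convolution (Rc : set (nat -> n.-tuple R)) :
  multi_ap Rc f -> multi_ap Rc F.
Proof.
move=> [_ fap]; split; first exact: tcontinuous_convolution.
move=> b /fap[k [fs [kinc hfs]]].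
set K := fine (\int[mu]_(u in pos) (op u)%:E)%E.
have K0 : 0 <= K by apply: fine_ge0; apply: integral_ge0 => u _; rewrite lee_fin.
have cau e : 0 < e -> exists N, forall l m, (N <= l)%N -> (N <= m)%N ->
    forall t, nrm (F (tadd t (b (k l))) - F (tadd t (b (k m)))) < e.
  (* Dividing by [K + 1] covers the case [K = 0] and makes the final inequality strict. *)
  move=> e0; have K1 : 0 < K + 1 by rewrite ltr_wpDl.
  have r0 : 0 < e / (K + 1) by rewrite divr_gt0.
  have r2 : 0 < e / (K + 1) / 2 by rewrite divr_gt0.
  have [N hN] := hfs _ r2; exists N => l m Nl Nm t.
  (* Translating [F] by [c] translates [f] by [c] at every point [tsub t u]; the uniform convergence
     of the translates of [f] thus bounds all [u] and [t] at once. *)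
  have taddE u c : tsub (tadd t c) u = tadd (tsub t u) c.
    by apply: eq_from_tnth => i; rewrite !(tnth_tsub, tnth_tadd) addrAC.
  rewrite (le_lt_trans (nrm_convolution_unif_le (ltW r0) _))//.
    move=> u; rewrite !taddE (le_trans (ler_nrm_distD (fs (tsub t u)) _ _))//.
    rewrite (splitr (e / (K + 1))) lerD//; first exact/ltW/hN.
    by rewrite nrm_distC; exact/ltW/hN.
  by rewrite -/K mulrAC ltr_pdivrMr// ltr_pM2l// ltrDl.
have lim t : exists v, forall e : R, 0 < e -> exists N, forall l, (N <= l)%N ->
     nrm (F (tadd t (b (k l))) - v) < e.
  apply: (nrm_complete (u := fun l => F (tadd t (b (k l))))) => e /cau[N hN].
  by exists N => l m Nl Nm; exact: hN.
have [Fs hFs] := choice lim.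
exists k, Fs; split => // e e0.
have e2 : 0 < e / 2 by rewrite divr_gt0.
have [N hN] := cau _ e2; exists N => l Nl t.
have [N' hN'] := hFs t _ e2.
(* The intermediate index depends on [t] through [N'], but the threshold [N] does not, so the
   pointwise limit is uniform. *)
rewrite (le_lt_trans (ler_nrm_distD (F (tadd t (b (k (maxn N N'))))) _ _))//.
by rewrite (splitr e) ltrD// ?hN ?hN' ?leq_maxl ?leq_maxr.
Qed.

End Convolution.

Theorem theorem2p53 (R : realType) (n : nat)
  (X Y : completeNormedModType R[i])
  (mu : {measure set (n.-tuple R) -> \bar R})
  (Rc : set (nat -> n.-tuple R))
  (Rop : n.-tuple R -> {linear X -> Y})
  (f : n.-tuple R -> X) :
  is_lebesgue_n mu ->
  Rc !=set0 ->
  (forall t, pos_orthant t -> bounded_op (Rop t)) ->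
  strongly_continuous (fun t => (Rop t : X -> Y)) ->
  (\int[mu]_(t in @pos_orthant R n) opnorm (Rop t) < +oo)%E ->
  (exists M : R, forall s, nrm (f s) <= M) ->
  multi_ap Rc f ->
  (forall t, exists v : Y,
     has_bochner_integral mu (lower_orthant t) (fun s => Rop (tsub t s) (f s)) v) /\
  (forall F : n.-tuple R -> Y,
     (forall t, has_bochner_integral mu (lower_orthant t)
                  (fun s => Rop (tsub t s) (f s)) (F t)) ->
     multi_ap Rc F).
Proof.
move=> leb _ bd sc int [M fM] fap; have fc : tcontinuous f by case: fap.
split; first exact: (exists_convolution leb bd sc int fM fc).
by move=> F hF; exact: (multi_ap_convolution leb bd sc int fM fc hF).
Qed.
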